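(* Let $X$ be a non-empty set and $R$ a binary relation on $X$. Then $\overline{R}$ has as realizer the set of linear-semiorder extensions of $R$ if and only if $R$ is acyclic.
   Context: For a binary relation $R$ on a set $X$, the asymmetric part is $P(R)=\{(x,y)\in X\times X : (x,y)\in R \text{ and } (y,x)\notin R\}$. The transitive closure $\overline{R}$ is defined by: $(x,y)\in\overline{R}$ iff there exist $m\geq 1$ and $z_0,\dots,z_m\in X$ with $x=z_0$, $z_m=y$ and $(z_k,z_{k+1})\in R$ for all $0\le k\le m-1$. An $R$-cycle is a non-empty subset $Y\subseteq X$ such that $(x,y)\in\overline{R}$ and $(y,x)\in\overline{R}$ for all $x,y\in Y$; $R$ is acyclic if there is no $R$-cycle. A relation $R^*$ on $X$ is an extension of $R$ if $R\subseteq R^*$ and $P(R)\subseteq P(R^* )$. A linear order is a reflexive, transitive, antisymmetric relation that is total (for all $x\neq y$, $xRy$ or $yRx$). An interval order is an irreflexive and transitive relation $R$ satisfying the Russell-Wiener axiom: for all $x,y,z,w\in X$, $(x,y)\in R$, $(z,y)\notin R$ and $(z,w)\in R$ imply $(x,w)\in R$. A semitransitive order is an irreflexive relation $R$ such that for all $x,y,z,w\in X$, $(x,y)\in R$ and $(y,z)\in R$ imply $(x,w)\in R$ or $(w,z)\in R$. A semiorder is an interval order which is also a semitransitive order. An acyclic binary relation $R$ is called a linear-semiorder if its transitive closure $\overline{R}$ is the intersection of a linear order and a semiorder on $X$. A linear-semiorder extension of $R$ is an extension of $R$ that is a linear-semiorder. A set $\mathcal{Q}$ of relations on $X$ is a realizer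 of a relation $S$ if $\mathcal{Q}$ is non-empty and $S=\bigcap_{Q\in\mathcal{Q}}Q$.
   Formalization: The realizing set is the linear-semiorder extensions of the transitive closure of R, not of R itself; as worded the claim fails for R={(1,2),(2,3)} on {1,2,3}, which is a linear-semiorder extension of itself omitting (1,3). *)

(* Defs.v *)
(* Vanilla Rocq, Stdlib relations: a binary relation on [X] is an [X -> X -> Prop],
   a set of relations is a predicate on [relation X]. *)
From Stdlib Require Export Relations.

Set Implicit Arguments.
Unset Strict Implicit.

Section Relations_on.
Variable X : Type.
Implicit Types (R S T L Q : relation X) (Y : X -> Prop).

Definition asym_part R : relation X := fun x y => R x y /\ ~ R y x.

(* A single point [x] with [R x x] is already a cycle. *)
Definition is_cycle R Y : Prop :=
  (exists x, Y x) /\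
  (forall x y, Y x -> Y y -> clos_trans X R x y /\ clos_trans X R y x).

Definition acyclic R : Prop := ~ exists Y, is_cycle R Y.

Definition extends R Q : Prop :=
  inclusion X R Q /\ inclusion X (asym_part R) (asym_part Q).

Definition irreflexive R : Prop := forall x, ~ R x x.

Definition total R : Prop := forall x y, x <> y -> R x y \/ R y x.

Definition linear_order L : Prop :=
  reflexive X L /\ transitive X L /\ antisymmetric X L /\ total L.

Definition russell_wiener R : Prop :=
  forall x y z w, R x y -> ~ R z y -> R z w -> R x w.

Definition interval_order R : Prop :=
  irreflexive R /\ transitive X R /\ russell_wiener R.

Definition semitransitive_order R : Prop :=
  irreflexive R /\
  (forall x y z w, R x y -> R y z -> R x w \/ R w z).

Definition semiorder R : Prop := interval_order R /\ semitransitive_order R.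

(* Only the transitive closure of [Q] has to be an intersection of two orders;
   [Q] itself need not be transitive. *)
Definition linear_semiorder Q : Prop :=
  acyclic Q /\
  exists L S, linear_order L /\ semiorder S /\
    same_relation X (clos_trans X Q) (fun x y => L x y /\ S x y).

(* The theorem applies this to [clos_trans X R], not to [R]: a non-transitive
   extension of [R] need not contain [clos_trans X R].  For instance
   [R = {(1,2), (2,3)}] is a linear-semiorder extension of itself that omits
   [(1,3)], so the linear-semiorder extensions of this acyclic [R] itself do
   not realize its transitive closure. *)
Definition linear_semiorder_extension R Q : Prop :=
  extends R Q /\ linear_semiorder Q.

Definition realizer (QQ : relation X -> Prop) S : Prop :=
  (exists Q, QQ Q) /\
  same_relation X S (fun x y => forall Q, QQ Q -> Q x y).

End Relations_on.

(* Main.v *)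
Require Import Defs.
From Stdlib Require Import Classical.
From mathcomp Require classical_sets.

Set Implicit Arguments.
Unset Strict Implicit.

(** A relation [R] is acyclic exactly when its transitive closure is a strict
    partial order, so the statement is about such orders.

    The key remark is that a strict linear order is already a linear-semiorder:
    it is a semiorder, and it is the intersection of itself with its reflexive
    closure, a linear order ([strict_linear_linear_semiorder]).  Among the
    linear-semiorder extensions of a strict partial order [S] are therefore all
    its strict linear extensions, and by the Dushnik-Miller argument these
    already intersect in [S]: if [S x y] fails, then either [x = y], and no
    strict linear extension relates [x] to [y], or [S] can be enlarged so as to
    put [y] below [x] ([strict_order_insert]) and then extended linearly by
    Szpilrajn's theorem ([szpilrajn]).

    Conversely, a cycle of [R] gives a pair [(x, x)] in the closure.  It would
    then lie in every linear-semiorder extension, one of which exists because a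
    realizer is non-empty, whereas a linear-semiorder is acyclic. *)

Definition strict_order (X : Type) (S : relation X) : Prop :=
  irreflexive S /\ transitive X S.

Lemma clos_trans_of_transitive (X : Type) (S : relation X) (x y : X) :
  transitive X S -> clos_trans X S x y -> S x y.
Proof.
  intros HS H; induction H as [x y H|x y z _ Hxy _ Hyz].
  - exact H.
  - exact (HS x y z Hxy Hyz).
Qed.

Lemma acyclic_iff_clos_trans_irreflexive (X : Type) (R : relation X) :
  acyclic R <-> irreflexive (clos_trans X R).
Proof.
  split.
  - intros HR x Hx; apply HR; exists (fun z => z = x); split.
    + exists x; reflexivity.
    + intros a b -> ->; split; exact Hx.
  - intros Hirr [Y [[x Yx] HY]].
    exact (Hirr x (proj1 (HY x x Yx Yx))).
Qed.

Lemma strict_order_acyclic (X : Type) (S : relation X) :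
  strict_order S -> acyclic S.
Proof.
  intros [Hirr Htr]; apply acyclic_iff_clos_trans_irreflexive; intros x Hx.
  exact (Hirr x (clos_trans_of_transitive Htr Hx)).
Qed.

(** Asymmetry of the larger order makes the condition on asymmetric parts
    automatic. *)
Lemma inclusion_strict_order_extends (X : Type) (S Q : relation X) :
  strict_order Q -> inclusion X S Q -> extends S Q.
Proof.
  intros [Hirr Htr] HSQ; split; [exact HSQ|].
  intros x y [Sxy _]; split; [exact (HSQ x y Sxy)|].
  intros Qyx; exact (Hirr x (Htr x y x (HSQ x y Sxy) Qyx)).
Qed.

Lemma strict_linear_negation (X : Type) (Q : relation X) (x y : X) :
  total Q -> ~ Q x y -> x = y \/ Q y x.
Proof.
  intros Htot Nxy; destruct (classic (x = y)) as [E|E]; [now left|right].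
  destruct (Htot x y E); [contradiction|assumption].
Qed.

(** In a strict linear order [~ Q z y] means that [y] is below or equal to [z],
    which turns the negative hypothesis of the Russell-Wiener axiom, and the
    failing alternative of semitransitivity, into a link of a chain. *)
Lemma strict_linear_semiorder (X : Type) (Q : relation X) :
  strict_order Q -> total Q -> semiorder Q.
Proof.
  intros [Hirr Htr] Htot; split.
  - split; [exact Hirr|split; [exact Htr|]].
    intros x y z w Qxy Nzy Qzw.
    destruct (strict_linear_negation Htot Nzy) as [->|Qyz].
    + exact (Htr x y w Qxy Qzw).
    + exact (Htr x z w (Htr x y z Qxy Qyz) Qzw).
  - split; [exact Hirr|].
    intros x y z w Qxy Qyz.
    destruct (classic (Q x w)) as [Qxw|Nxw]; [now left|right].
    assert (Qxz := Htr x y z Qxy Qyz).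
    destruct (strict_linear_negation Htot Nxw) as [<-|Qwx].
    + exact Qxz.
    + exact (Htr w x z Qwx Qxz).
Qed.

Lemma strict_linear_reflexive_closure (X : Type) (Q : relation X) :
  strict_order Q -> total Q -> linear_order (fun x y => x = y \/ Q x y).
Proof.
  intros [Hirr Htr] Htot; split; [|split; [|split]].
  - intros x; now left.
  - intros x y z [->|Qxy] [->|Qyz]; auto.
    right; exact (Htr x y z Qxy Qyz).
  - intros x y [E|Qxy] [E'|Qyx]; auto.
    destruct (Hirr x (Htr x y x Qxy Qyx)).
  - intros x y Nxy; destruct (Htot x y Nxy); auto.
Qed.

Lemma strict_linear_linear_semiorder (X : Type) (Q : relation X) :
  strict_order Q -> total Q -> linear_semiorder Q.
Proof.
  intros HQ Htot; split; [exact (strict_order_acyclic HQ)|].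
  exists (fun x y => x = y \/ Q x y), Q; split; [|split].
  - exact (strict_linear_reflexive_closure HQ Htot).
  - exact (strict_linear_semiorder HQ Htot).
  - split; intros x y.
    + intros H; apply (clos_trans_of_transitive (proj2 HQ)) in H; auto.
    + intros [_ H]; now apply t_step.
Qed.

(** The transitive closure of [S] with the pair [(u, v)] added, when [S] is
    transitive: a chain using the new pair goes from below [u] to above [v]. *)
Definition insert (X : Type) (S : relation X) (u v : X) : relation X :=
  fun a b => S a b \/ (a = u \/ S a u) /\ (v = b \/ S v b).

(** A loop through the new pair, or a chain using it twice, would yield
    [v = u] or [S v u]. *)
Lemma strict_order_insert (X : Type) (S : relation X) (u v : X) :
  strict_order S -> u <> v -> ~ S v u -> strict_order (insert S u v).
Proof.
  intros [Hirr Htr] Nuv Nvu.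
  assert (Hback : forall a, v = a \/ S v a -> a = u \/ S a u -> False).
  { intros a [<-|Sva] [E|Sau]; subst; auto.
    exact (Nvu (Htr v a u Sva Sau)). }
  split.
  - intros a [Saa|[Hau Hva]]; [exact (Hirr a Saa)|exact (Hback a Hva Hau)].
  - intros a b c [Sab|[Hau Hvb]] [Sbc|[Hbu Hvc]].
    + left; exact (Htr a b c Sab Sbc).
    + right; split; [right|exact Hvc].
      destruct Hbu as [<-|Sbu]; [exact Sab|exact (Htr a b u Sab Sbu)].
    + right; split; [exact Hau|right].
      destruct Hvb as [->|Svb]; [exact Sbc|exact (Htr v b c Svb Sbc)].
    + destruct (Hback b Hvb Hbu).
Qed.

(** A strict order maximal among those containing [S] is total, since an
    incomparable pair could be inserted.  Zorn's lemma is applied to sets [A]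
    of pairs such that [S] together with [A] is a strict order, rather than to
    the orders containing [S]: the empty chain then needs no separate
    treatment, as its union yields [S] itself. *)
Theorem szpilrajn (X : Type) (S : relation X) :
  strict_order S ->
  exists Q, strict_order Q /\ total Q /\ inclusion X S Q.
Proof.
  intros HS.
  set (with_pairs := fun (A : X * X -> Prop) x y => S x y \/ A (x, y)).
  destruct (@classical_sets.Zorn_bigcup (X * X)
              (fun A => strict_order (with_pairs A))) as [A [HA Hmax]].
  - intros F HF Hchain; split.
    + intros x [Sxx|[A FA Axx]]; [exact (proj1 HS x Sxx)|].
      exact (proj1 (HF A FA) x (or_intror Axx)).
    + assert (Hin : forall A x z, F A -> with_pairs A x z ->
                with_pairs (classical_sets.bigcup F (fun B => B)) x z).
      { intros A x z FA [Sxz|Axz]; [now left|right; now exists A]. }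
      intros x y z [Sxy|[A FA Axy]] [Syz|[B FB Byz]].
      * left; exact (proj2 HS x y z Sxy Syz).
      * apply (Hin B); [exact FB|].
        exact (proj2 (HF B FB) x y z (or_introl Sxy) (or_intror Byz)).
      * apply (Hin A); [exact FA|].
        exact (proj2 (HF A FA) x y z (or_intror Axy) (or_introl Syz)).
      * (* Two pairs of the union already lie in a common member of the chain. *)
        destruct (Hchain A B FA FB) as [AB|BA].
        -- apply (Hin B); [exact FB|].
           exact (proj2 (HF B FB) x y z (or_intror (AB _ Axy)) (or_intror Byz)).
        -- apply (Hin A); [exact FA|].
           exact (proj2 (HF A FA) x y z (or_intror Axy) (or_intror (BA _ Byz))).
  - exists (with_pairs A); split; [exact HA|split].
    + intros x y Nxy; apply NNPP; intros Hinc.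
      assert (Nyx : ~ with_pairs A y x) by tauto.
      set (Q := insert (with_pairs A) x y).
      apply (Hmax (fun p => Q (fst p) (snd p))).
      * split.
        -- intros [a b] Hab; left; right; exact Hab.
        -- intros Hsub; apply Hinc; left; right.
           apply (Hsub (x, y)); right; auto.
      * destruct (strict_order_insert HA Nxy Nyx) as [Qirr Qtr].
        (* [S] is contained in [Q], so adding it to [Q] changes nothing. *)
        assert (HQ : forall a b,
                  with_pairs (fun p => Q (fst p) (snd p)) a b -> Q a b).
        { intros a b [Sab|Qab]; [left; now left|exact Qab]. }
        split.
        -- intros a Haa; exact (Qirr a (HQ a a Haa)).
        -- intros a b c Hab Hbc; right.
           exact (Qtr a b c (HQ a b Hab) (HQ b c Hbc)).
    + intros x y Sxy; now left.
Qed.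

(** Strict linear extensions separate [S] from any pair outside it: it suffices
    to reverse that pair before extending. *)
Lemma strict_linear_extension_avoiding (X : Type) (S : relation X) (x y : X) :
  strict_order S -> ~ S x y ->
  exists Q, strict_order Q /\ total Q /\ inclusion X S Q /\ ~ Q x y.
Proof.
  intros HS Nxy; destruct (classic (y = x)) as [->|Nyx].
  - destruct (szpilrajn HS) as [Q [HQ [Htot HSQ]]].
    exists Q; split; [exact HQ|split; [exact Htot|split; [exact HSQ|]]].
    apply (proj1 HQ).
  - destruct (szpilrajn (strict_order_insert HS Nyx Nxy))
      as [Q [HQ [Htot HSQ]]].
    exists Q; split; [exact HQ|split; [exact Htot|split]].
    + intros a b Sab; apply HSQ; now left.
    + intros Qxy; apply (proj1 HQ x), (proj2 HQ x y x Qxy).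
      apply HSQ; right; auto.
Qed.

Lemma strict_linear_extension_is_linear_semiorder_extension
  (X : Type) (S Q : relation X) :
  strict_order Q -> total Q -> inclusion X S Q ->
  linear_semiorder_extension S Q.
Proof.
  intros HQ Htot HSQ; split.
  - exact (inclusion_strict_order_extends HQ HSQ).
  - exact (strict_linear_linear_semiorder HQ Htot).
Qed.

Theorem theorem4p10 (X : Type) (hX : inhabited X) (R : relation X) :
  realizer (linear_semiorder_extension (clos_trans X R)) (clos_trans X R)
  <-> acyclic R.
Proof.
  split.
  - intros [[Q [[HRQ _] [HQ _]]] _].
    apply acyclic_iff_clos_trans_irreflexive; intros x Hxx.
    apply (proj1 (acyclic_iff_clos_trans_irreflexive Q) HQ x), t_step.
    exact (HRQ x x Hxx).
  - intros HR.
    assert (HS : strict_order (clos_trans X R)).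
    { split; [now apply acyclic_iff_clos_trans_irreflexive|].
      intros x y z; apply t_trans. }
    split; [|split].
    + destruct (szpilrajn HS) as [Q [HQ [Htot HSQ]]].
      exists Q; now apply strict_linear_extension_is_linear_semiorder_extension.
    + intros x y Hxy Q [[HSQ _] _]; exact (HSQ x y Hxy).
    + intros x y Hall; apply NNPP; intros Nxy.
      destruct (strict_linear_extension_avoiding HS Nxy)
        as [Q [HQ [Htot [HSQ NQ]]]].
      apply NQ, Hall.
      now apply strict_linear_extension_is_linear_semiorder_extension.
Qed.
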